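(* Let $(X,d,m)$ be a compact Ahlfors $Q$-regular space, $Q>0$, let $1<p<+\infty$, $\frac1p+\frac1{p'}=1$, and $\frac1{p'}\le s<1$. There exists a constant $\Psi=\Psi(X,p,s)\ge1$ such that for all $M\ge1$ there exists a constant $1<\tilde A<+\infty$, depending only on $X$, $p$, $s$ and $M$, with the following property: for any countable family $\{B_d(x_k,r_k)\}_{k\in\mathcal F}$ of balls in $X$ such that the radii $\eta_{X,p}(x_k,M\cdot r_k)$ exist and the family $\{B_d(x_k,\Psi\cdot\eta^*_{X,p}(x_k,M\cdot r_k))\}_{k\in\mathcal F}$ is disjoint, and for any compact set $E\subseteq X$ such that $E=\bigcup_{k\in\mathcal F}E_k$ with $E_k\subseteq B_d(x_k,r_k)$ for all $k$, one has $$\sum_{k\in\mathcal F}C_{K_{X,s},p}(E_k)\le\tilde A\cdot C_{K_{X,s},p}(E).$$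
   Context: $(X,d,m)$ is a compact metric measure space, $B_d(x,r)=\{y\in X: d(x,y)<r\}$. It is Ahlfors $Q$-regular: there are constants $0<C_1\le C_2<+\infty$ with $C_1r^Q\le m(B_d(x,r))\le C_2r^Q$ for all $x\in X$ and $0<r<\mathrm{diam}(X)$. Throughout, $m$ is taken to be the $Q$-dimensional Hausdorff measure (in particular it is a regular Borel measure). Riesz kernel: $K_{X,s}(x,y)=d(x,y)^{-Qs}$ (equal to $+\infty$ on the diagonal), and $K_{X,s}*f(x)=\int_X K_{X,s}(x,y)f(y)\,dm(y)$. Capacity: for $E\subseteq X$, $C_{K_{X,s},p}(E):=\inf\{\|f\|^p_{L^p(X,m)}: f\in L^p(X,m),\ K_{X,s}*f(x)\ge1\ \forall x\in E\}$. Radii: for $x\in X$, $r>0$, $$\eta_{X,p}(x,r):=\inf\{R>0: m(B_d(x,R))\ge C_{K_{X,s},p}(B_d(x,r))\},$$ which is said to exist when the set on the right is non-empty, and $\eta^*_{X,p}(x,r):=\max\{r,\eta_{X,p}(x,r)\}$. *)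

(* Defs.v *)
From HB Require Import structures.
From mathcomp Require Import all_boot all_order all_algebra.
From mathcomp Require Import all_classical all_reals all_analysis.

Set Implicit Arguments.
Unset Strict Implicit.
Unset Printing Implicit Defensive.

Import Order.TTheory GRing.Theory Num.Theory.
Import numFieldNormedType.Exports.

Local Open Scope classical_set_scope.
Local Open Scope ring_scope.
Local Open Scope ereal_scope.

(* measurableType extends pointedType, hence the distinguished point, which
   only records that the space is nonempty. *)
#[short(type="pointedMetricType")]
HB.structure Definition PointedMetric (K : numDomainType) :=
  {M of Metric K M & Pointed M}.

Notation borel X := (g_sigma_algebraType (@open X)).

Section hausdorff_measure.
Context {R : realType} {X : metricType R}.
Implicit Types A : set X.

(* The maximum with 0 only serves to give diam set0 = 0 rather than -oo. *)
Definition diam A : \bar R :=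
  maxe 0 (ereal_sup [set (mdist xy.1 xy.2)%:E | xy in A `*` A]).

Definition hausdorff_premeasure (Q delta : R) A : \bar R :=
  ereal_inf [set \sum_(k <oo) diam (F k) `^ Q | F in
    [set F : (set X)^nat | A `<=` \bigcup_k F k /\
                           forall k, diam (F k) <= delta%:E]].

(* Normalisation: sums of diam^Q, with no multiplicative constant. *)
Definition hausdorff_measure (Q : R) A : \bar R :=
  ereal_sup [set hausdorff_premeasure Q delta A | delta in
    [set delta : R | (0 < delta)%R]].

End hausdorff_measure.

Section riesz_capacity.
Context {R : realType} {X : pointedMetricType R}.
Variable m : {measure set (borel X) -> \bar R}.
Implicit Types Q p s r : R.

Definition ahlfors_regular Q :=
  exists C1 C2 : R, [/\ (0 < C1)%R, (C1 <= C2)%R &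
    forall (x : X) (r : R), (0 < r)%R -> r%:E < diam [set: X] ->
      (C1 * r `^ Q)%:E <= m (ball x r) /\ m (ball x r) <= (C2 * r `^ Q)%:E].

(* The case split is needed because powR 0 y = 0 for y != 0. *)
Definition riesz_kernel Q s (x y : X) : \bar R :=
  if x == y then +oo else (mdist x y `^ (- (Q * s)))%:E.

Definition riesz_potential Q s (f : X -> R) (x : X) : \bar R :=
  \int[m]_y (riesz_kernel Q s x y * (f y)%:E).

(* A signed f is admitted; where the integral defining the potential has the
   form oo - oo, it evaluates to -oo, so the constraint fails. *)
Definition capacity Q s p (E : set X) : \bar R :=
  ereal_inf [set 'N[m]_p%:E [EFin \o f] `^ p | f in
    [set f : borel X -> R | f \in Lfun m p%:E /\
       forall x, E x -> 1 <= riesz_potential Q s f x]].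

Definition eta_radii Q s p (x : X) r : set R :=
  [set t : R | (0 < t)%R /\ capacity Q s p (ball x r) <= m (ball x t)].

Definition eta_exists Q s p (x : X) r := eta_radii Q s p x r !=set0.

Definition eta Q s p (x : X) r : R := inf (eta_radii Q s p x r).

Definition eta_star Q s p (x : X) r : R := Num.max r (eta Q s p x r).

End riesz_capacity.

(* Main.v *)
Require Import Defs.
From HB Require Import structures.
From mathcomp Require Import all_boot all_order all_algebra.
From mathcomp Require Import finmap.
From mathcomp Require Import all_classical all_reals all_analysis.
From mathcomp Require Import measurable_realfun ring lra.

Set Implicit Arguments.
Unset Strict Implicit.
Unset Printing Implicit Defensive.

Import Order.TTheory GRing.Theory Num.Theory.
Import numFieldNormedType.Exports.
Local Open Scope classical_set_scope.
Local Open Scope ring_scope.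

(* Let g be an admissible function for E, B* = B(x_k, 4 eta*_k) and
   B' = B(x_k, 2 eta*_k). If the part of the potential of g coming from B* is at
   least 1/2 on E_k, then 2 g 1_{B*} is admissible for E_k. Otherwise the part
   coming from the complement of B* is at least 1/2 at some point of E_k, hence
   by the Harnack inequality for the kernel bounded below at x_k, while
   C(E_k) <= m(B') by definition of eta*_k. With t <= e + e^(1-p) t^p and the
   uniform bound on the integral of the kernel, this gives in all cases
     C(E_k) <= 2^p int_{B*} g^p
               + c m(B') int_{X \ B*} K(x_k, z) g(z)^p dm(z).
   The first terms are summed by disjointness. For the second ones, Harnack
   again bounds the sum over k of m(B') 1_{X \ B*}(z) K(x_k, z) by a multiple of
   the integral of K(z, .) over the disjoint union of the B', which is bounded.
   That bound follows from Ahlfors regularity by summing over dyadic balls. *)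

(** * Measurability and Harnack inequality of the Riesz kernel *)

Section metric_kernel.
Context {R : realType} {X : pointedMetricType R}.
Implicit Types (x y z : X) (r a : R).

Lemma mdist_continuous x : continuous (mdist x : X -> R).
Proof.
move=> y; apply/cvgrPdist_lt => e e0.
apply/nbhs_ballP; exists e => //= z; rewrite ballEmdist/= => yz.
rewrite ltr_norml; have := metric_triangle x y z; have := metric_triangle x z y.
by rewrite (metric_sym z y); lra.
Qed.

Lemma mdist_measurable x :
  measurable_fun [set: borel X] (mdist x : borel X -> R).
Proof.
apply: (measurability _ (RGenOpens.measurableE R)) => _ [_ [a [b ->] <-]].
rewrite setTI; apply: sub_sigma_algebra.
by have /continuousP := @mdist_continuous x; apply; exact: interval_open.
Qed.

Lemma mdist_ball_open x r : open (ball x r).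
Proof.
rewrite ballEmdist (_ : [set y | _] = mdist x @^-1` [set t | t < r])//.
by have /continuousP := @mdist_continuous x; apply; exact: open_lt.
Qed.

Lemma measurable_ball x r : measurable (ball x r : set (borel X)).
Proof. by apply: sub_sigma_algebra; exact: mdist_ball_open. Qed.

Lemma riesz_kernel_ge0 (Q s : R) x y : (0 <= riesz_kernel Q s x y)%E.
Proof.
by rewrite /riesz_kernel; case: ifP => // _; rewrite lee_fin powR_ge0.
Qed.

Lemma riesz_kernel_sym (Q s : R) x y :
  riesz_kernel Q s x y = riesz_kernel Q s y x.
Proof. by rewrite /riesz_kernel eq_sym metric_sym. Qed.

Lemma riesz_kernel_measurable (Q s : R) x :
  measurable_fun [set: borel X] (riesz_kernel Q s x : borel X -> \bar R).
Proof.
rewrite /riesz_kernel.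
apply: (measurable_fun_ifT (T1 := borel X) (f := eq_op x)) => //.
  apply: (measurable_fun_bool true); rewrite setTI.
  (* The singleton of [x] is measurable as a sublevel set of the distance to [x]. *)
  have -> : eq_op x @^-1` [set true] = [set y | mdist x y <= 0].
    by apply/seteqP; split => y /=; rewrite leNgt mdist_gt0 negbK.
  have -> : [set y | mdist x y <= 0] = mdist x @^-1` `]-oo, 0]%classic.
    by apply/seteqP; split => y /=; rewrite in_itv.
  rewrite -[X in measurable X]setTI; exact: mdist_measurable.
apply/measurable_EFinP.
exact: (measurableT_comp (measurable_powR (- (Q * s))) (mdist_measurable x)).
Qed.

(** The kernel is a nonincreasing power of the distance, so doubling the distance costs at most the
    factor 2^(Qs). The condition [x != z] keeps the left side finite; for [y = z] the right side is
    +oo. *)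
Lemma riesz_kernel_harnack (Q s : R) x y z : 0 <= Q * s -> x != z ->
  mdist y z <= 2 * mdist x z ->
  (riesz_kernel Q s x z <= (2 `^ (Q * s))%:E * riesz_kernel Q s y z)%E.
Proof.
move=> Qs xz yxz; rewrite /riesz_kernel (negbTE xz).
case: eqVneq => [_|yz]; first by rewrite gt0_muley ?leey// lte_fin powR_gt0.
rewrite -EFinM lee_fin !powRN ler_pdivlMr ?powR_gt0 ?mdist_gt0//.
rewrite mulrC ler_pdivrMr ?powR_gt0 ?mdist_gt0// -powRM ?mdist_ge0//.
by apply: ge0_ler_powR => //; rewrite nnegrE ?mulr_ge0 ?mdist_ge0.
Qed.

End metric_kernel.

(** * Dyadic majorant of the kernel *)

Section kernel_dyadic.
Context {R : realType} {X : pointedMetricType R}.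
Implicit Types (x y z : X) (r a : R).
Local Open Scope ereal_scope.

Lemma powR_exprn (q b : R) (j : nat) : (0 <= q)%R ->
  ((q ^+ j) `^ b = (q `^ b) ^+ j)%R.
Proof.
move=> q0; elim: j => [|j ih]; first by rewrite !expr0 powR1.
by rewrite !exprS powRM ?exprn_ge0// ih.
Qed.

Lemma nneseries_geometric_le (a q : R) : (0 <= a)%R -> (0 < q < 1)%R ->
  \sum_(j <oo) (a * q ^+ j)%:E <= (a / (1 - q))%:E.
Proof.
move=> a0 /andP[q0 q1]; apply: lime_le.
  apply: is_cvg_nneseries => n _ _.
  by rewrite lee_fin mulr_ge0// exprn_ge0// ltW.
apply: nearW => n; rewrite sumEFin lee_fin.
by apply: (geometric_le_lim n) => //; rewrite gtr0_norm.
Qed.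

(* On the diagonal both sides are +oo: the series has terms bounded below. *)
Lemma riesz_kernel_dyadic (Q s r0 : R) x y : (0 <= Q * s)%R -> (0 < r0)%R ->
  riesz_kernel Q s x y <= (r0 `^ (- (Q * s)))%:E +
    \sum_(j <oo) ((r0 * 2^-1 ^+ j.+1) `^ (- (Q * s)))%:E *
                 (\1_(ball x (r0 * 2^-1 ^+ j)) y)%:E.
Proof.
move=> Qs r0_gt0; set S := (X in _ <= _ + X).
have term_ge0 (j : nat) : 0 <= ((r0 * 2^-1 ^+ j.+1) `^ (- (Q * s)))%:E *
                 (\1_(ball x (r0 * 2^-1 ^+ j)) y)%:E :> \bar R.
  by rewrite mule_ge0 ?lee_fin ?powR_ge0// indicE.
have S_ge0 : 0 <= S by apply: nneseries_ge0 => n _ _; exact: term_ge0.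
have powRNle (u v : R) : (0 < u)%R -> (u <= v)%R ->
    (v `^ (- (Q * s)) <= u `^ (- (Q * s)))%R.
  move=> u0 uv; rewrite !powRN lef_pV2 ?posrE ?powR_gt0 ?(lt_le_trans u0)//.
  by apply: ge0_ler_powR => //; rewrite nnegrE ltW// (lt_le_trans u0).
have q_gt0 : (0 < 2^-1 :> R)%R by rewrite invr_gt0.
rewrite /riesz_kernel; case: eqVneq => [xy|xy].
  suff -> : S = +oo by rewrite addey// ltNye.
  apply: eq_infty => t; set n := Num.bound (`|t| / r0 `^ (- (Q * s))).
  have c0 : (0 < r0 `^ (- (Q * s)))%R by exact: powR_gt0.
  rewrite (le_trans _ (nneseries_lim_ge n _))//.
  apply: (@le_trans _ _ (\sum_(0 <= j < n) (r0 `^ (- (Q * s)))%:E)).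
    rewrite sumEFin lee_fin sumr_const_nat subn0 -mulr_natl.
    rewrite (le_trans (ler_norm _))// -ler_pdivrMr// ltW//.
    by apply: archi_boundP; rewrite divr_ge0// ltW.
  apply: lee_sum => j _; rewrite indicE mem_set ?mule1; last first.
    by rewrite ballEmdist/= xy mdistxx mulr_gt0// exprn_gt0.
  rewrite lee_fin powRNle//; first by rewrite mulr_gt0// exprn_gt0.
  by rewrite ger_pMr// exprn_ile1// ?invf_le1// ?ler1n// ltW.
have d0 : (0 < mdist x y)%R by rewrite mdist_gt0.
(* At distance at least [r0] the constant term alone dominates. *)
have [r0d|dr0] := leP r0 (mdist x y).
  by rewrite (le_trans _ (leeDl _ S_ge0))// lee_fin powRNle.
have : exists n, (r0 * 2^-1 ^+ n <= mdist x y)%R.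
  have q1 : (`|2^-1 : R| < 1)%R by rewrite gtr0_norm// invf_lt1// ltr1n.
  have /cvgrPdist_lt/(_ _ d0) := cvg_geometric r0 q1.
  move=> [n _ /(_ n (leqnn _))] /=.
  rewrite sub0r normrN => /ltW h; exists n; apply: le_trans h.
  exact: ler_norm.
(* The least n with r0 2^-n <= d(x,y) is positive because d(x,y) < r0. Writing n = j+1 puts [y] in
   the shell between radii r0 2^-(j+1) and r0 2^-j, where the term of index [j] alone dominates the
   kernel. *)
move=> /ex_minnP[[|j] jd jmin].
  by move: jd; rewrite expr0 mulr1 leNgt dr0.
have dj : (mdist x y < r0 * 2^-1 ^+ j)%R.
  by rewrite ltNge; apply/negP => /jmin; rewrite ltnn.
rewrite (@le_trans _ _ S) ?leeDr ?lee_fin ?powR_ge0//.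
rewrite (le_trans _ (nneseries_lim_ge j.+1 _))//.
rewrite big_nat_recr//=; apply: (le_trans _ (leeDr _ _)); last exact: sume_ge0.
rewrite indicE mem_set ?mule1; last by rewrite ballEmdist.
by rewrite lee_fin powRNle// mulr_gt0// exprn_gt0.
Qed.

End kernel_dyadic.

(** * Uniform bound on the integral of the kernel *)

Section kernel_integral.
Context {R : realType} {X : pointedMetricType R}.
Context (m : {measure set (borel X) -> \bar R}).
Implicit Types (x y z : X) (r a : R).
Local Open Scope ereal_scope.

(** Integrate the dyadic majorant term by term. The term of index j gives at most (r0
    2^-(j+1))^(-Qs) C (r0 2^-j)^Q, which is geometric in j. *)
Lemma riesz_kernel_integral_le (Q s C D r0 : R) :
  (0 < Q)%R -> (0 <= s < 1)%R -> (0 < r0)%R -> (0 <= C)%R ->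
  m [set: X] <= D%:E ->
  (forall x r, (0 < r <= r0)%R -> m (ball x r) <= (C * r `^ Q)%:E) ->
  exists B : R, forall x, \int[m]_y riesz_kernel Q s x y <= B%:E.
Proof.
move=> Q0 /andP[s0 s1] r00 C0 mD mball; set a := (Q * s)%R.
have a0 : (0 <= a)%R by rewrite mulr_ge0// ltW.
have q_gt0 : (0 < 2^-1 :> R)%R by rewrite invr_gt0.
(* The ratio [q] is 2^(-Q(1-s)), below 1 because s < 1; [c] is the bound on the term of index 0. *)
pose q : R := (2^-1 `^ (- a) * 2^-1 `^ Q)%R.
pose c : R := (r0 `^ (- a) * 2^-1 `^ (- a) * (C * r0 `^ Q))%R.
have q01 : (0 < q < 1)%R.
  rewrite /q mulr_gt0 ?powR_gt0//= -powRD; last first.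
    by apply/implyP => _; rewrite gt_eqF.
  rewrite /powR gt_eqF// expR_lt1.
  have lnq : (ln (2^-1 : R) < 0)%R by rewrite ln_lt0// q_gt0 invf_lt1// ltr1n.
  by rewrite pmulr_rlt0// addrC subr_gt0 /a gtr_pMr.
exists (r0 `^ (- a) * D + c / (1 - q))%R => x.
pose u j (y : X) : \bar R := ((r0 * 2^-1 ^+ j.+1) `^ (- a))%:E *
                 (\1_(ball x (r0 * 2^-1 ^+ j)) y)%:E.
have u_ge0 j y : 0 <= u j y by rewrite mule_ge0 ?lee_fin ?powR_ge0// indicE.
have mind j : measurable_fun [set: borel X]
    (fun y : borel X => (\1_(ball x (r0 * 2^-1 ^+ j)) y)%:E : \bar R).
  apply/measurable_EFinP; apply: measurable_indic; exact: measurable_ball.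
have mu j : measurable_fun [set: borel X] (u j : borel X -> \bar R).
  exact: emeasurable_funM.
have msum : measurable_fun [set: borel X]
    (fun y : borel X => \sum_(j <oo) u j y).
  exact: ge0_emeasurable_sum.
apply: (@le_trans _ _ (\int[m]_y ((r0 `^ (- a))%:E + \sum_(j <oo) u j y))).
  apply: ge0_le_integral => //.
  - by move=> y _; exact: riesz_kernel_ge0.
  - exact: riesz_kernel_measurable.
  - exact: emeasurable_funD.
  - by move=> y _; exact: riesz_kernel_dyadic.
rewrite ge0_integralD//=; last 2 first.
  - by move=> y _; rewrite lee_fin powR_ge0.
  - by move=> y _; apply: nneseries_ge0.
rewrite EFinD integral_cst// EFinM leeD ?lee_wpmul2l ?lee_fin ?powR_ge0//.
rewrite integral_nneseries//.
apply: le_trans (nneseries_geometric_le _ q01); last first.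
  by rewrite /c !mulr_ge0// powR_ge0.
apply: lee_nneseries => [j _ _|j _]; first exact: integral_ge0.
rewrite ge0_integralZl_EFin ?powR_ge0// integral_indic//; last first.
  exact: measurable_ball.
rewrite setIT (le_trans (lee_wpmul2l _ (mball _ _ _)))//.
- by rewrite lee_fin powR_ge0.
- have q_le1 : (2^-1 <= 1 :> R)%R by rewrite invf_le1// ler1n.
  by rewrite mulr_gt0 ?exprn_gt0//= ger_pMr// exprn_ile1// ltW.
rewrite -EFinM lee_fin /c /q !powRM ?exprn_ge0 ?(ltW q_gt0) ?(ltW r00)//.
rewrite !powR_exprn ?(ltW q_gt0)// exprS exprMn le_eqVlt; apply/orP; left.
by apply/eqP; ring.
Qed.

End kernel_integral.

(** * Kernel bound on a compact Ahlfors regular space *)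

Section regular_space.
Context {R : realType} {X : pointedMetricType R}.
Context (m : {measure set (borel X) -> \bar R}).
Implicit Types (x y z : X) (r a : R).
Local Open Scope ereal_scope.

(** Finitely many balls of radius [r0] cover the space. *)
Lemma compact_fin_measure (r0 : R) : compact [set: X] -> (0 < r0)%R ->
  (forall x, m (ball x r0) < +oo) -> m [set: X] < +oo.
Proof.
rewrite compact_cover => cX r00 mball.
have [x _|x _|D _ DX] := cX X [set: X] (fun x => ball x r0).
- exact: mdist_ball_open.
- by exists x => //; exact: ballxx.
apply: (le_lt_trans (content_sub_fsum m (finite_fset D) _ _ DX)) => //.
  by move=> x _; exact: measurable_ball.
by rewrite fsbig_finite//= lte_sum_pinfty.
Qed.

Lemma regular_kernel_bound (Q s : R) : compact [set: X] -> (0 < Q)%R -> 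
  (forall A : set (borel X), measurable A ->
     m A = hausdorff_measure Q (A : set X)) ->
  ahlfors_regular m Q -> (0 <= s < 1)%R ->
  exists2 B : R, (0 < B)%R & forall x, \int[m]_y riesz_kernel Q s x y <= B%:E.
Proof.
move=> cX Q0 mH [C1 [C2 [C10 C12 mX]]] s01.
suff [r0 [C [D [r00 C0 mD mball]]]] : exists r0 C D : R,
    [/\ (0 < r0)%R, (0 <= C)%R, m [set: X] <= D%:E &
     forall x r, (0 < r <= r0)%R -> m (ball x r) <= (C * r `^ Q)%:E].
  have [B HB] := riesz_kernel_integral_le Q0 s01 r00 C0 mD mball.
  exists (Num.max 1 B)%R; first by rewrite lt_max ltr01.
  by move=> x; rewrite (le_trans (HB x))// lee_fin le_max lexx orbT.
(* With diameter 0 the regularity condition is vacuous. The identification with Hausdorff measure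
   then gives m(X) = 0: cover by copies of the whole space, each contributing 0^Q = 0. *)
have [d0|d0] := eqVneq (diam [set: X]) 0.
  have mX0 : m [set: X] <= 0.
    rewrite mH//; apply: ge_ereal_sup => _ [d /= d_gt0 <-].
    apply: ge_ereal_inf; exists 0 => //.
    exists (fun=> [set: X]).
      split; first by move=> x _; exists 0%N.
      by move=> _; rewrite d0 lee_fin ltW.
    by rewrite eseries0// => k _ _; rewrite d0 poweR0r// gt_eqF.
  exists 1%R, 0%R, 0%R; split => // x r _; rewrite mul0r.
  apply: le_trans mX0; apply: le_measure => //; rewrite inE//.
  exact: measurable_ball.
have {d0} d0 : 0 < diam [set: X].
  by rewrite lt_neqAle eq_sym d0 /diam le_max lexx.
(* Regularity speaks of radii strictly below the diameter, so [r0] is taken below it; [diam] is an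
   extended real, whence the separate case +oo. *)
have [r0 r00 r0d] : exists2 r0 : R, (0 < r0)%R & r0%:E < diam [set: X].
  move: (diam _) d0 => [d| |]//.
  - by rewrite lte_fin => d_gt0; exists (d / 2)%R; rewrite ?lte_fin; lra.
  - by exists 1%R => //; exact: ltry.
have mball x r : (0 < r <= r0)%R -> m (ball x r) <= (C2 * r `^ Q)%:E.
  move=> /andP[r_gt0 rr0]; apply: (mX x r r_gt0 _).2.
  by rewrite (le_lt_trans _ r0d)// lee_fin.
have mfin : m [set: X] < +oo.
  apply: (compact_fin_measure cX r00) => x.
  by rewrite (le_lt_trans (mball _ _ _)) ?r00 ?lexx ?ltry.
exists r0, C2, (fine (m [set: X])); split => //; first by lra.
by rewrite fineK// ge0_fin_numE.
Qed.

End regular_space.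

(** * Integrals over disjoint sets and general bounds on the capacity *)

Lemma sum_integral_le d (T : measurableType d) (R : realType)
    (mu : {measure set T -> \bar R}) (I : eqType) (D : I -> set T) (s : seq I)
    (h : T -> \bar R) :
  (forall i, measurable (D i)) -> uniq s -> trivIset [set` s] D ->
  measurable_fun [set: T] h -> (forall y, 0 <= h y)%E ->
  (\sum_(i <- s) \int[mu]_(y in D i) h y <= \int[mu]_y h y)%E.
Proof.
move=> mD us tD mh h0; rewrite -ge0_integral_bigsetU//; last first.
  exact: measurable_funTS.
by apply: ge0_subset_integral => //; exact: bigsetU_measurable.
Qed.

Section capacity_estimates.
Context {R : realType} {X : pointedMetricType R}.
Context (m : {measure set (borel X) -> \bar R}).
Implicit Types (x y z : X) (r a : R) (f g : borel X -> R).
Local Open Scope ereal_scope.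

(** For t <= e the first term suffices; for t > e the second does, since (t/e)^(p-1) >= 1. The
    parameter [e] stays free, so that the contribution of the constant term can be made small. *)
Lemma le_young_powR (p e t : R) : (1 < p)%R -> (0 < e)%R -> (0 <= t)%R ->
  (t <= e + e `^ (1 - p) * t `^ p)%R.
Proof.
move=> p1 e0 t0; have [te|et] := leP t e.
  by rewrite (le_trans te)// lerDl mulr_ge0// powR_ge0.
have t_gt0 : (0 < t)%R by rewrite (lt_trans e0).
rewrite (@le_trans _ _ (e `^ (1 - p) * t `^ p)%R) ?lerDr ?(ltW e0)//.
have -> : (t `^ p = t * t `^ (p - 1))%R.
  by rewrite mulr_powRB1// (lt_trans _ p1).
rewrite mulrCA ler_pMr// -opprB powRN mulrC ler_pdivlMr ?powR_gt0// mul1r.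
by apply: ge0_ler_powR; rewrite ?nnegrE ?ltW// subr_gt0.
Qed.

(** Measurability replaces membership in L^p: an infinite integral makes the bound trivial. *)
Lemma capacity_le (Q s p : R) f (E : set X) : (0 < p)%R ->
  measurable_fun [set: borel X] f ->
  (forall x, E x -> 1 <= riesz_potential m Q s f x) ->
  capacity m Q s p E <= \int[m]_y (`|f y| `^ p)%:E.
Proof.
move=> p0 mf Ef; have [->|foo] := eqVneq (\int[m]_y (`|f y| `^ p)%:E) +oo.
  exact: leey.
apply: ge_ereal_inf; exists ('N[m]_p%:E [EFin \o f] `^ p); last first.
  by rewrite poweR_Lnorm ?gt_eqF.
exists f => //; split => //; apply/andP; rewrite !inE; split => //=.
rewrite /finite_norm unlock /=.
by apply: poweR_lty; rewrite ltey.
Qed.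

(** Dropping the integral of the negative part can only increase the potential, also in the case oo
    - oo, and the positive part of K f is at most K |f|. *)
Lemma riesz_potential_le_abs (Q s : R) f x : measurable_fun [set: borel X] f ->
  riesz_potential m Q s f x <= riesz_potential m Q s (fun y => `|f y|%R) x.
Proof.
move=> mf; rewrite /riesz_potential integralE.
have mK := @riesz_kernel_measurable R X Q s x.
have K0 := @riesz_kernel_ge0 R X Q s x.
have mKf : measurable_fun [set: borel X]
    (fun y : borel X => riesz_kernel Q s x y * (f y)%:E).
  by apply: emeasurable_funM => //; exact/measurable_EFinP.
pose Kf y := riesz_kernel Q s x y * (f y)%:E.
rewrite (@le_trans _ _ (\int[m]_y Kf^\+ y))//.
  by rewrite -[leRHS]sube0 leeB// integral_ge0.
apply: ge0_le_integral => //.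
- exact: measurable_funepos.
- apply: emeasurable_funM => //; apply/measurable_EFinP.
  exact: measurableT_comp.
- move=> y _; rewrite funeposE ge_max mule_ge0 ?lee_fin//= andbT.
  by rewrite lee_wpmul2l// lee_fin ler_norm.
Qed.

(** Only nonnegative test functions need be considered: passing from f to |f| keeps the norm and
    does not decrease the potential. *)
Lemma le_capacity (Q s p : R) (E : set X) (b : \bar R) : (0 < p)%R ->
  (forall g, measurable_fun [set: borel X] g -> (forall y, 0 <= g y)%R ->
     (forall x, E x -> 1 <= riesz_potential m Q s g x) ->
     b <= \int[m]_y (g y `^ p)%:E) ->
  b <= capacity m Q s p E.
Proof.
move=> p0 H; apply: le_ereal_inf_tmp => _ [f [/sub_Lfun_mfun + Ef] <-].
rewrite inE => mf; rewrite poweR_Lnorm ?gt_eqF//.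
apply: (le_trans (H (fun y => `|f y|%R) _ _ _)) => //.
- exact: measurableT_comp.
- by move=> x Ex; rewrite (le_trans (Ef x Ex))// riesz_potential_le_abs.
Qed.

Lemma capacity_subset (Q s p : R) (E E' : set X) : E `<=` E' ->
  capacity m Q s p E <= capacity m Q s p E'.
Proof.
move=> EE'; apply: ereal_inf_le_tmp => _ [f [fL fE'] <-].
by exists f => //; split => // x /EE'; exact: fE'.
Qed.

End capacity_estimates.

(** * Quasi-additivity for finite families of balls *)

Section quasi_additivity.
Context {R : realType} {X : pointedMetricType R}.
Context (m : {measure set (borel X) -> \bar R}) (Q s p B : R).
Context (Qs_ge0 : 0 <= Q * s) (p_gt1 : 1 < p) (B_gt0 : 0 < B).
Context (kernel_le : forall x, (\int[m]_y riesz_kernel Q s x y <= B%:E)%E).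
Implicit Types (x y z : X) (r a : R) (g : borel X -> R).
Local Open Scope ereal_scope.

Let K : X -> borel X -> \bar R := riesz_kernel Q s.
Let h : R := (2 `^ (Q * s))%R.
(* With this e, the term e of Young's inequality contributes h * e * B = 1/4. *)
Let e : R := (4 * h * B)^-1.
(** Chosen so that 1/2 <= 1/4 + h e^(1-p) J becomes 1 <= c J. *)
Let c : R := (4 * h * e `^ (1 - p))%R.

Let h_gt0 : (0 < h)%R. Proof. exact: powR_gt0. Qed.

Let e_gt0 : (0 < e)%R. Proof. by rewrite invr_gt0 !mulr_gt0. Qed.

Let c_gt0 : (0 < c)%R. Proof. by rewrite !mulr_gt0// powR_gt0. Qed.

Let p_gt0 : (0 < p)%R. Proof. exact: lt_trans p_gt1. Qed.

Let K_ge0 x y : 0 <= K x y. Proof. exact: riesz_kernel_ge0. Qed.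

Let K_meas x D : measurable_fun D (K x).
Proof. exact: measurable_funTS (@riesz_kernel_measurable R X Q s x). Qed.

Lemma capacity_ball_part g (D : set (borel X)) (E : set X) :
  measurable D -> measurable_fun [set: borel X] g -> (forall y, 0 <= g y)%R ->
  (forall x, E x -> 2^-1%:E <= \int[m]_(y in D) (K x y * (g y)%:E)) ->
  capacity m Q s p E <= (2 `^ p)%:E * \int[m]_(y in D) (g y `^ p)%:E.
Proof.
move=> mD mg g0 Eg; pose f y := (2 * g y * \1_D y)%R.
have mf : measurable_fun [set: borel X] f.
  by apply: measurable_funM; [exact: measurable_funM|exact: measurable_indic].
rewrite (le_trans (capacity_le p_gt0 mf _))//.
  move=> x Ex; rewrite /riesz_potential.
  (* Off [D] the integrand vanishes even where the kernel is infinite, by the convention that +oo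
     times 0 is 0. *)
  have -> : \int[m]_y (riesz_kernel Q s x y * (f y)%:E) =
            \int[m]_(y in D) (2%:E * (K x y * (g y)%:E)).
    rewrite [RHS]integral_mkcond; apply: eq_integral => y _.
    rewrite /f patchE indicE; case: ifP => _; last by rewrite mulr0 mule0.
    by rewrite mulr1 EFinM muleCA.
  rewrite ge0_integralZl_EFin//; last 2 first.
  - by move=> y _; rewrite mule_ge0 ?lee_fin.
  - apply: emeasurable_funM => //; apply/measurable_EFinP.
    exact: measurable_funTS.
  have := lee_wpmul2l (_ : 0 <= 2%:E :> \bar R) (Eg x Ex).
  by rewrite -EFinM mulfV// lee_fin; apply.
rewrite -ge0_integralZl_EFin ?powR_ge0//; last 2 first.
- by move=> y _; rewrite lee_fin powR_ge0.
- apply/measurable_EFinP; apply: (measurableT_comp (measurable_powR p)).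
  exact: measurable_funTS.
rewrite [leRHS]integral_mkcond le_eqVlt; apply/orP; left.
apply/eqP/eq_integral => y _.
rewrite /f patchE indicE; case: ifP => _.
  by rewrite mulr1 ger0_norm ?mulr_ge0// powRM// EFinM.
by rewrite mulr0 normr0 powR0// gt_eqF.
Qed.

(** For z in [D], d(x,z) > 3 rho > d(x0,x), hence d(x0,z) <= 2 d(x,z) and Harnack moves the kernel
    from [x] to the centre [x0]. Young's inequality then replaces g by e + e^(1-p) g^p, and the
    constant part contributes at most 1/4. *)
Lemma far_part_ge g x0 rho x (D : set (borel X) := ~` ball x0 (4 * rho)%R) :
  (0 < rho)%R -> (mdist x0 x < rho)%R ->
  measurable_fun [set: borel X] g -> (forall y, 0 <= g y)%R ->
  2^-1%:E <= \int[m]_(y in D) (K x y * (g y)%:E) ->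
  1 <= c%:E * \int[m]_(y in D) (K x0 y * (g y `^ p)%:E).
Proof.
move=> rho0 x0x mg g0 half.
have mD : measurable D by apply: measurableC; exact: measurable_ball.
have mgp : measurable_fun D (fun y => (g y `^ p)%:E).
  apply/measurable_EFinP; apply: (measurableT_comp (measurable_powR p)).
  exact: measurable_funTS.
set J := \int[m]_(y in D) _.
have J0 : 0 <= J.
  by apply: integral_ge0 => y _; rewrite mule_ge0// lee_fin powR_ge0.
have mKg : measurable_fun D (fun y => K x0 y * (g y `^ p)%:E).
  exact: emeasurable_funM.
have quarter : 2^-1%:E <= 4^-1%:E + (h * e `^ (1 - p))%:E * J.
  apply: (le_trans half).
  apply: (@le_trans _ _ (\int[m]_(y in D) ((h * e)%:E * K x0 y +
      (h * e `^ (1 - p))%:E * (K x0 y * (g y `^ p)%:E)))).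
    apply: ge0_le_integral => //.
    - by move=> y _; rewrite mule_ge0// lee_fin.
    - apply: emeasurable_funM => //; apply/measurable_EFinP.
      exact: measurable_funTS.
    - by apply: emeasurable_funD; exact: measurable_funeM.
    - move=> z; rewrite /D /setC/= ballEmdist/= => /negP; rewrite -leNgt => x0z.
      have xz0 : (mdist x0 z <= mdist x0 x + mdist x z)%R.
        exact: metric_triangle.
      have xz : x != z by rewrite -mdist_gt0; lra.
      apply: (@le_trans _ _
        ((h%:E * K x0 z) * (e + e `^ (1 - p) * g z `^ p)%:E)).
        apply: lee_pmul => //; rewrite ?lee_fin//.
          by apply: riesz_kernel_harnack => //; lra.
        exact: le_young_powR.
      rewrite EFinD ge0_muleDr ?lee_fin ?mulr_ge0 ?powR_ge0 ?(ltW e_gt0)//.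
      rewrite !EFinM.
      by rewrite (muleAC h%:E) !muleA (muleAC h%:E (K x0 z)).
  rewrite ge0_integralD//; last 4 first.
  - by move=> y _; rewrite mule_ge0// lee_fin mulr_ge0 ?ltW.
  - exact: measurable_funeM.
  - by move=> y _; rewrite !mule_ge0 ?lee_fin ?mulr_ge0 ?powR_ge0 ?(ltW h_gt0).
  - exact: measurable_funeM.
  rewrite !ge0_integralZl_EFin//; first last.
  - by rewrite mulr_ge0 ?ltW.
  - by rewrite mulr_ge0 ?powR_ge0 ?ltW.
  - by move=> y _; rewrite mule_ge0// lee_fin powR_ge0.
  rewrite leeD2r//.
  apply: (@le_trans _ _ ((h * e)%:E * B%:E)).
    apply: lee_wpmul2l; first by rewrite lee_fin mulr_ge0 ?ltW.
    by apply: le_trans (kernel_le x0); apply: ge0_subset_integral.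
  rewrite -EFinM lee_fin /e le_eqVlt; apply/orP; left; apply/eqP; field.
  by rewrite !gt_eqF.
(* An infinite J satisfies the conclusion trivially; a finite one leaves a linear inequality between
   reals. *)
move: J0 quarter; case: J => [t||]// => [|_ _]; last first.
  by rewrite gt0_muley ?leey// lte_fin.
rewrite -!EFinM -EFinD !lee_fin /c -!mulrA.
by move: (h * _)%R => u; lra.
Qed.

(** The near case gives the first term. In the far case C(E) <= m(B') is multiplied by the bound 1
    <= c J of [far_part_ge]. The sum of both terms holds in either case and can be added over the
    family. *)
Lemma capacity_local g x0 rho (E : set X) :
  (0 < rho)%R -> E `<=` ball x0 rho ->
  capacity m Q s p E <= m (ball x0 (2 * rho)%R) ->
  measurable_fun [set: borel X] g -> (forall y, 0 <= g y)%R ->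
  (forall x, E x -> 1 <= riesz_potential m Q s g x) ->
  capacity m Q s p E <=
    (2 `^ p)%:E *
      \int[m]_(y in (ball x0 (4 * rho)%R : set (borel X))) (g y `^ p)%:E +
    c%:E * (m (ball x0 (2 * rho)%R) *
      \int[m]_(y in (~` ball x0 (4 * rho)%R : set (borel X)))
        (K x0 y * (g y `^ p)%:E)).
Proof.
move=> rho0 Eball capE mg g0 Eg; set D : set (borel X) := ball x0 (4 * rho)%R.
have mD : measurable D by exact: measurable_ball.
have I1 : 0 <= \int[m]_(y in D) (g y `^ p)%:E.
  by apply: integral_ge0 => y _; rewrite lee_fin powR_ge0.
have I2 : 0 <= \int[m]_(y in ~` D) (K x0 y * (g y `^ p)%:E).
  by apply: integral_ge0 => y _; rewrite mule_ge0// lee_fin powR_ge0.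
have [near_part|] := pselect (forall x, E x ->
    2^-1%:E <= \int[m]_(y in D) (K x y * (g y)%:E)).
  rewrite (le_trans (capacity_ball_part mD mg g0 near_part))// leeDl//.
  by rewrite !mule_ge0// lee_fin ltW.
(* One point of [E] with near part below 1/2 is enough, since its far part is transferred to the
   centre [x0]. *)
move=> /existsNP[x /not_implyP[Ex /negP]]; rewrite -ltNge => near_lt.
have mKg : measurable_fun [set: borel X] (fun y => K x y * (g y)%:E).
  by apply: emeasurable_funM => //; exact/measurable_EFinP.
have Kg0 y : 0 <= K x y * (g y)%:E by rewrite mule_ge0// lee_fin.
have far : 2^-1%:E <= \int[m]_(y in ~` D) (K x y * (g y)%:E).
  rewrite leNgt; apply/negP => far_lt; have := Eg x Ex.
  rewrite /riesz_potential -(setUv D) ge0_integral_setU ?setUv//; last 2 first.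
  - exact: measurableC.
  - exact/disj_setPCl.
  rewrite leNgt => /negP; apply.
  by rewrite (_ : 1 = 2^-1%:E + 2^-1%:E) ?lteD// -EFinD; congr EFin; field.
have x0x : (mdist x0 x < rho)%R by have := Eball x Ex; rewrite ballEmdist.
have := far_part_ge rho0 x0x mg g0 far; rewrite -/D => cJ.
rewrite (le_trans capE)//.
rewrite (le_trans _ (leeDr _ _)) ?mule_ge0 ?lee_fin ?powR_ge0//.
by rewrite muleCA -[leLHS]mule1 lee_wpmul2l.
Qed.

(** The left side is the integral over B' of the constant K(x0,z). For y in B' and z outside B*,
    d(y,z) < 2 rho + d(x0,z) <= 2 d(x0,z), so Harnack compares this constant with K(y,z) =
    K(z,y). *)
Lemma ball_mass_kernel_le x0 rho z : (0 < rho)%R ->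
  m (ball x0 (2 * rho)%R) * (K x0 \_ (~` ball x0 (4 * rho)%R)) z <=
  h%:E * \int[m]_(y in (ball x0 (2 * rho)%R : set (borel X))) K z y.
Proof.
move=> rho0; have mB : measurable (ball x0 (2 * rho)%R : set (borel X)).
  exact: measurable_ball.
have I0 : 0 <= \int[m]_(y in (ball x0 (2 * rho)%R : set (borel X))) K z y.
  exact: integral_ge0.
rewrite patchE; case: ifPn => [|_]; last first.
  by rewrite mule0 mule_ge0// lee_fin ltW.
rewrite inE /setC/= ballEmdist/= => /negP; rewrite -leNgt => x0z.
rewrite muleC -integral_cst// -ge0_integralZl_EFin ?(ltW h_gt0)//.
apply: ge0_le_integral => //.
- move=> y _; exact: K_ge0.
- exact: measurable_funeM.
move=> y; rewrite ballEmdist/= => x0y; rewrite [K z y]riesz_kernel_sym.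
apply: riesz_kernel_harnack => //; first by rewrite -mdist_gt0; lra.
have := metric_triangle y x0 z; rewrite (metric_sym y x0); lra.
Qed.

(** A single g admissible for [E] is admissible for every [E_ k], so the local estimates can be
    added with the same g. The constant is 2^p + c h B, fixed before the family. *)
Lemma sum_capacity_le : exists2 A : R, (1 < A)%R &
  forall (I : choiceType) (ks : seq I) (x : I -> X) (rho : I -> R)
    (E_ : I -> set X) (E : set X),
  uniq ks -> (forall k, k \in ks -> (0 < rho k)%R) ->
  trivIset [set` ks] (fun k => ball (x k) (4 * rho k)%R) ->
  (forall k, k \in ks -> E_ k `<=` ball (x k) (rho k)) ->
  (forall k, k \in ks -> E_ k `<=` E) ->
  (forall k, k \in ks ->
     capacity m Q s p (E_ k) <= m (ball (x k) (2 * rho k)%R)) ->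
  \sum_(k <- ks) capacity m Q s p (E_ k) <= A%:E * capacity m Q s p E.
Proof.
have p1 : (1 < 2 `^ p)%R.
  by rewrite (@lt_le_trans _ _ 2%R)// ?ltr1n// le1r_powR ?ler1n// ltW.
pose A : R := (2 `^ p + c * (h * B))%R.
have chB : (0 <= c * (h * B))%R by rewrite ltW// mulr_gt0// mulr_gt0.
have A1 : (1 < A)%R by rewrite /A (lt_le_trans p1)// lerDl.
exists A => // I ks x rho E_ E us rho0 tD E_ball E_E capE_.
have A0 : (0 < A)%R by rewrite (lt_trans _ A1).
(* Dividing by [A] isolates the capacity of [E], so that the infimum can be taken over g. *)
rewrite muleC -lee_pdivrMr//; apply: le_capacity => // g mg g0 Eg.
rewrite lee_pdivrMr// muleC.
pose G (y : borel X) : \bar R := (g y `^ p)%:E.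
have G0 y : 0 <= G y by rewrite lee_fin powR_ge0.
have mG : measurable_fun [set: borel X] G.
  by apply/measurable_EFinP; exact: (measurableT_comp (measurable_powR p)).
pose Bn k : set (borel X) := ball (x k) (4 * rho k)%R.
pose Bh k : set (borel X) := ball (x k) (2 * rho k)%R.
have mBn k : measurable (Bn k) by exact: measurable_ball.
have mBh k : measurable (Bh k) by exact: measurable_ball.
pose w k (z : borel X) := m (Bh k) * (K (x k) \_ (~` Bn k)) z.
have patch0 k z : 0 <= (K (x k) \_ (~` Bn k)) z by rewrite patchE; case: ifP.
have w0 k z : 0 <= w k z by rewrite mule_ge0.
have mw k : measurable_fun [set: borel X] (w k).
  apply: measurable_funeM; apply: (measurable_restrictT _ _).1 => //.
  exact: measurableC.
(* Absorbing the mass and the domain into the weight [w k] makes all integrals run over the whole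
   space, where sum and integral can be exchanged. *)
have wE k : m (Bh k) * \int[m]_(y in ~` Bn k) (K (x k) y * G y) =
    \int[m]_z (w k z * G z).
  rewrite [X in _ * X]integral_mkcond -ge0_integralZl//; last 2 first.
  - apply: (measurable_restrictT _ _).1; first exact: measurableC.
    by apply: emeasurable_funM => //; exact: measurable_funTS.
  - by move=> z _; rewrite patchE; case: ifP => // _; rewrite mule_ge0.
  apply: eq_integral => z _; rewrite /w !patchE.
  by case: ifP => _; rewrite ?muleA// !mule0 mul0e.
have sumw z : \sum_(k <- ks) w k z <= (h * B)%:E.
  apply: (@le_trans _ _ (\sum_(k <- ks) h%:E * \int[m]_(y in Bh k) K z y)).
    rewrite big_seq [leRHS]big_seq; apply: lee_sum => k k_ks.
    exact: ball_mass_kernel_le (rho0 k k_ks).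
  rewrite -ge0_sume_distrr; last by move=> k _; exact: integral_ge0.
  rewrite EFinM lee_wpmul2l ?lee_fin ?(ltW h_gt0)//.
  apply: le_trans (kernel_le z); apply: sum_integral_le => //.
  apply/trivIsetP => i j is_ js_ ij; move/trivIsetP : tD => /(_ i j is_ js_ ij).
  apply: subsetI_eq0; rewrite /Bh !ballEmdist => y /=.
    by have := rho0 i is_; lra.
  by have := rho0 j js_; lra.
apply: (@le_trans _ _ (\sum_(k <- ks) ((2 `^ p)%:E * \int[m]_(y in Bn k) G y +
    c%:E * \int[m]_z (w k z * G z)))).
  rewrite big_seq [leRHS]big_seq; apply: lee_sum => k k_ks.
  rewrite -wE; apply: capacity_local => //;
    [exact: rho0|exact: E_ball|exact: capE_|].
  by move=> y /(E_E k k_ks); exact: Eg.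
rewrite big_split/= -!ge0_sume_distrr; last 2 first.
- by move=> k _; apply: integral_ge0 => z _; rewrite mule_ge0.
- by move=> k _; apply: integral_ge0.
rewrite /A EFinD ge0_muleDl ?lee_fin ?powR_ge0//.
apply: leeD.
  rewrite lee_wpmul2l ?lee_fin ?powR_ge0//.
  by apply: sum_integral_le => //; exact: (@measurable_ball R X).
rewrite (EFinM c) -muleA lee_wpmul2l ?lee_fin ?(ltW c_gt0)//.
rewrite -ge0_integral_sum//; last 2 first.
- by move=> k; exact: emeasurable_funM.
- by move=> k z _; rewrite mule_ge0.
rewrite -ge0_integralZl_EFin//; last 2 first.
- by move=> z _; exact: G0.
- by rewrite mulr_ge0 ?ltW.
apply: ge0_le_integral => //.
- by move=> z _; apply: sume_ge0 => k _; rewrite mule_ge0.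
- by apply: emeasurable_sum => k; exact: emeasurable_funM.
- exact: measurable_funeM.
- by move=> z _; rewrite -ge0_sume_distrl// lee_wpmul2r.
Qed.

End quasi_additivity.

(** * From finite to countable families, with the radii [eta_star] *)

Theorem theorem2p4 (R : realType) (X : pointedMetricType R)
    (m : {measure set (borel X) -> \bar R}) (Q p p' s : R)
    (X_compact : compact [set: X])
    (Q_gt0 : 0 < Q)
    (m_hausdorff : forall A : set (borel X), measurable A ->
       m A = hausdorff_measure Q (A : set X))
    (X_regular : ahlfors_regular m Q)
    (p_gt1 : 1 < p)
    (pp' : p^-1 + p'^-1 = 1)
    (s_ge : p'^-1 <= s)
    (s_lt1 : s < 1) :
  exists2 Psi : R, 1 <= Psi &
  forall M : R, 1 <= M ->
  exists2 A : R, 1 < A &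
  forall (I : choiceType) (F : set I) (x : I -> X) (r : I -> R),
    countable F ->
    (forall k, F k -> 0 < r k) ->
    (forall k, F k -> eta_exists m Q s p (x k) (M * r k)) ->
    trivIset F (fun k => ball (x k) (Psi * eta_star m Q s p (x k) (M * r k))) ->
  forall (E : set X) (E_ : I -> set X),
    compact E ->
    E = \bigcup_(k in F) E_ k ->
    (forall k, F k -> E_ k `<=` ball (x k) (r k)) ->
  (\esum_(k in F) capacity m Q s p (E_ k) <= A%:E * capacity m Q s p E)%E.
Proof.
have p_gt0 : 0 < p by exact: lt_trans p_gt1.
have s_gt0 : 0 < s.
  by have : p^-1 < 1; [rewrite invf_lt1|move: pp' s_ge; lra].
have s01 : 0 <= s < 1 by rewrite s_lt1 ltW.
have Qs_ge0 : 0 <= Q * s by rewrite ltW// mulr_gt0.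
have [B B_gt0 kernel_le] :=
  regular_kernel_bound X_compact Q_gt0 m_hausdorff X_regular s01.
have [A A_gt1 HA] := sum_capacity_le Qs_ge0 p_gt1 B_gt0 kernel_le.
(* With rho = [eta_star], the factor 4 makes the given disjoint balls the balls B*. The constant [A]
   is fixed before [M], so one value serves every [M]. *)
exists 4; first by rewrite ler1n.
move=> M M_ge1; exists A => // I F x r _ r_gt0 eta_ex disj E E_ _ EE E_ball.
(* The sum over [F] is the supremum of its finite subsums, so a bound uniform in the finite set [S]
   suffices. *)
apply: ub_ereal_sup => _ [S [S_fin SF] <-].
rewrite fsbig_finite//=.
have inF k : k \in fset_set S -> F k by rewrite in_fset_set// => /set_mem/SF.
have rM k : F k -> r k <= M * r k by move=> Fk; rewrite ler_peMl// ltW// r_gt0.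
have r_le k : F k -> r k <= eta_star m Q s p (x k) (M * r k).
  by move=> /rM rk; rewrite /eta_star le_max rk.
have star_gt0 k : F k -> 0 < eta_star m Q s p (x k) (M * r k).
  by move=> Fk; rewrite (lt_le_trans (r_gt0 k Fk))// r_le.
have sub_ball k a b : a <= b -> ball (x k) a `<=` ball (x k) b.
  by move=> ab; exact: le_ball.
apply: (HA I _ x (fun k => eta_star m Q s p (x k) (M * r k))) => //.
- by move=> k /inF; exact: star_gt0.
- by apply: sub_trivIset disj => k /= /inF.
- move=> k /inF Fk.
  exact: subset_trans (E_ball k Fk) (sub_ball k _ _ (r_le k Fk)).
- by move=> k /inF Fk y Eky; rewrite EE; exists k.
- move=> k /inF Fk.
  have E_M := subset_trans (E_ball k Fk) (sub_ball k _ _ (rM k Fk)).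
  apply: le_trans (capacity_subset m Q s p E_M) _.
  (* The infimum need not be attained. As [eta_star] is positive, doubling leaves strict room for an
     actual radius t of the nonempty set [eta_radii], and then B(x_k, t) lies in B'. *)
  have etalt : inf (eta_radii m Q s p (x k) (M * r k)) <
      2 * eta_star m Q s p (x k) (M * r k).
    have : Defs.eta m Q s p (x k) (M * r k) <= eta_star m Q s p (x k) (M * r k).
      by rewrite /eta_star le_max lexx orbT.
    by have := star_gt0 k Fk; rewrite /Defs.eta; lra.
  have [t [_ cap_t] t_lt] := inf_lt (eta_ex k Fk) etalt.
  rewrite (le_trans cap_t)//.
  apply: le_measure; last exact: sub_ball (ltW t_lt).
  - by rewrite inE; exact: measurable_ball.
  - by rewrite inE; exact: measurable_ball.
Qed.
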